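(* Let $\alpha\in\mathbb{R}^n$ be a real vector and $\mu\in\mathbb{R}^n_+$ a non-negative vector such that the weights $\mu$ are monotone in the degrees $d$ (i.e., for all $i,j\in V$, $1<d_i<d_j$ implies $\mu_i\leqslant\mu_j$) and the matrix $\mathrm{diag}(\alpha)+\mu\mu^\top-A$ is positive semidefinite. Then for any tree $T\in\mathcal{T}(d)$ $$C_A(T)\geqslant LB(\alpha,\mu):=\frac{n-1}{2}\sum_{i,j=1}^n\mu_{ij}-\left(\frac{n-1}{2}\sum_{i=1}^n\alpha_i+\mu^\top P(H(\mu))\mu\right),$$ where $H(\mu)\in\mathcal{H}(\mu,d)$ is a Huffman tree for the weight sequence $\mu$ and degree sequence $d$. In other words, $LB(\alpha,\mu)$ is a lower bound for $\min_{T\in\mathcal{T}(d)}C_A(T)$.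
   Context: Let $V=\{1,\dots,n\}$ be a set of terminals and $A=(\mu_{ij})_{i,j=1}^n$ a symmetric non-negative flow matrix (the entries $\mu_{ij}$ of $A$ are distinct from the components $\mu_i$ of the weight vector $\mu$). Let $d=(d_1,\dots,d_n)$ be a generating degree sequence, i.e., a sequence of natural numbers with $\sum_{i=1}^n d_i=2(n-1)$, and let $\mathcal{T}(d)$ be the set of trees on vertex set $V$ in which vertex $i$ has degree $d_i$ for all $i$. For a tree $T$, $D(T)=(d_T(i,j))_{i,j=1}^n$ is its shortest-path distance matrix, and the cost is $C_A(T)=\sum_{\{i,j\}\subset V}\mu_{ij}d_T(i,j)=\frac12\mathrm{tr}\,D(T)A$ (the proof in the paper works with $C_A(T)=\mathrm{tr}\,D(T)A$). Let $J$ be the $n\times n$ all-ones matrix and $P(T):=\frac{n-1}{2}J-D(T)$; $P(T)$ is positive semidefinite for every tree $T$ of order $n$. For a weight vector $\mu$, the vertex-weighted Wiener index is $WI_\mu(T)=\mu^\top D(T)\mu$. $\mathcal{H}(\mu,d)$ denotes the set of trees produced by the generalized Huffman algorithm for weights $\mu$ and degrees $d$: starting from the set $W$ of pendent vertices ($d_i=1$) and the set $M$ of internal vertices, it repeatedly picks $m\in M$ of least current weight (ties broken by least degree), attaches to it the $d_m-1$ vertices of least weight in $W$, removes them from $W$, adds their weights to $\mu_m$, and moves $m$ from $M$ to $W$; when one internal vertex remains it is joined to all remaining vertices of $W$. It is known that if $\mu$ is monotone in $d$, every minimizer of $WI_\mu$ over $\mathcal{T}(d)$ is such a Huffman tree,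 and all Huffman trees in $\mathcal{H}(\mu,d)$ share the same value of $WI_\mu$.
   Formalization: The cost C_A(T) is taken as tr D(T)A (sum over ordered pairs), not the half-sum over unordered pairs, for which the bound fails (e.g. the path on 3 vertices, A=J-I, μ=(1,1,1), α=(-1,-1,-1): LB=8 but the half-sum is 4). *)

(* Defs.v *)
From HB Require Import structures.
From mathcomp Require Import all_boot all_order all_algebra.
Set Implicit Arguments. Unset Strict Implicit. Unset Printing Implicit Defensive.
Import Order.TTheory GRing.Theory Num.Theory.
Local Open Scope ring_scope.

(* e is a tree: a simple (symmetric, irreflexive) connected graph with
   exactly n-1 (unordered) edges, i.e. 2(n-1) ordered adjacent pairs. *)
Definition is_tree (n : nat) (e : rel 'I_n) : Prop :=
  [/\ symmetric e, irreflexive e, (forall i j, connect e i j)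
    & #|[set p : 'I_n * 'I_n | e p.1 p.2]| = (2 * (n - 1))%N].

Definition deg (n : nat) (e : rel 'I_n) (i : 'I_n) : nat := #|[set j | e i j]|.

Definition tree_with_degrees (n : nat) (d : 'I_n -> nat) (e : rel 'I_n) : Prop :=
  is_tree e /\ forall i, deg e i = d i.

Definition generating_degseq (n : nat) (d : 'I_n -> nat) : Prop :=
  (\sum_(i < n) d i)%N = (2 * (n - 1))%N.

Fixpoint reach (n : nat) (e : rel 'I_n) (k : nat) (i j : 'I_n) : bool :=
  match k with
  | 0 => i == j
  | k'.+1 => reach e k' i j || [exists m, reach e k' i m && e m j]
  end.

(* shortest-path distance: the least k < n such that j is reachable from i
   within k steps (for a connected graph on n vertices this is d_T(i,j)) *)
Definition dist (n : nat) (e : rel 'I_n) (i j : 'I_n) : nat :=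
  find (fun k => reach e k i j) (iota 0 n).

Definition distmx (R : ringType) (n : nat) (e : rel 'I_n) : 'M[R]_n :=
  \matrix_(i, j) (dist e i j)%:R.

Definition Pmx (R : fieldType) (n : nat) (e : rel 'I_n) : 'M[R]_n :=
  ((n - 1)%:R / 2) *: const_mx 1 - distmx R e.

(* cost C_A(T) = tr (D(T) A) (the convention used in the paper's proof) *)
Definition cost (R : ringType) (n : nat) (A : 'M[R]_n) (e : rel 'I_n) : R :=
  \tr (distmx R e *m A).

Definition wiener (R : ringType) (n : nat) (mu : 'cV[R]_n) (e : rel 'I_n) : R :=
  (mu^T *m distmx R e *m mu) 0 0.

Definition psd (R : numDomainType) (n : nat) (M : 'M[R]_n) : Prop :=
  forall x : 'cV[R]_n, 0 <= (x^T *m M *m x) 0 0.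

Definition monotone_in (R : numDomainType) (n : nat) (mu : 'cV[R]_n) (d : 'I_n -> nat) :=
  forall i j : 'I_n, (1 < d i)%N -> (d i < d j)%N -> mu i 0 <= mu j 0.

Definition add_star (n : nat) (E : rel 'I_n) (m : 'I_n) (S : {set 'I_n}) : rel 'I_n :=
  fun x y => [|| E x y, (x == m) && (y \in S) | (y == m) && (x \in S)].

(* Runs of the generalized Huffman algorithm.
   huff_run d W M w E T : starting from the current state (set W of "free"
   vertices, set M of remaining internal vertices, current weights w, edges
   built so far E), the algorithm can terminate with the tree T. *)
Inductive huff_run (R : numDomainType) (n : nat) (d : 'I_n -> nat) :
  {set 'I_n} -> {set 'I_n} -> ('I_n -> R) -> rel 'I_n -> rel 'I_n -> Prop :=
| huff_step (W M : {set 'I_n}) (w : 'I_n -> R) (E : rel 'I_n) (T : rel 'I_n)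
    (m : 'I_n) (S : {set 'I_n}) :
    (1 < #|M|)%N ->
    m \in M ->
    (forall m', m' \in M -> w m <= w m') ->
    (forall m', m' \in M -> w m' = w m -> (d m <= d m')%N) ->
    S \subset W ->
    #|S| = (d m).-1 ->
    (forall s t, s \in S -> t \in W :\: S -> w s <= w t) ->
    huff_run d (m |: (W :\: S)) (M :\ m)
      (fun x => if x == m then w m + \sum_(s in S) w s else w x)
      (add_star E m S) T ->
    huff_run d W M w E T
| huff_last (W M : {set 'I_n}) (w : 'I_n -> R) (E : rel 'I_n) (m : 'I_n) :
    M = [set m] ->
    huff_run d W M w E (add_star E m W)
| huff_degenerate (W M : {set 'I_n}) (w : 'I_n -> R) (E : rel 'I_n) (a b : 'I_n) :
    (* no internal vertex at all (only possible for n = 2): join the two leaves *)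
    M = set0 -> a != b -> W = [set a; b] ->
    huff_run d W M w E (add_star E a [set b]).

Definition huffman_tree (R : numDomainType) (n : nat) (mu : 'cV[R]_n)
    (d : 'I_n -> nat) (T : rel 'I_n) : Prop :=
  huff_run d [set i | d i == 1%N] [set i | (1 < d i)%N] (fun i => mu i 0)
    (fun _ _ => false) T.

Definition LB (R : realFieldType) (n : nat) (A : 'M[R]_n) (alpha mu : 'cV[R]_n)
    (H : rel 'I_n) : R :=
  (n - 1)%:R / 2 * (\sum_(i < n) \sum_(j < n) A i j)
  - ((n - 1)%:R / 2 * (\sum_(i < n) alpha i 0) + (mu^T *m Pmx R H *m mu) 0 0).

(* Main.v *)
(* If e runs over the edges of a tree T and s_e = +1 or -1 on the two sides of e, then
   P(T) = 1/2 sum_e s_e s_e^T; hence tr(P(T) X) >= 0 for every positive semidefinite X, and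
   X = diag(alpha) + mu mu^T - A gives the bound with T itself in place of H(mu).

   It remains to see that a Huffman tree minimizes the Wiener index.  Let T be any tree of T(d)
   containing the forest built so far, and let v be an internal vertex of maximal transmission
   sum_z mu_z d(v,z); it is pendant among the remaining internal vertices.  Giving its position to
   the vertex m picked by the algorithm, and its branches to the lightest ones S, only moves weight
   away from v.  To first order in the moved weights this does not increase the index, by the
   choice of v; the second-order term is a value of the quadratic form D(T) on a vector of zero
   sum, which is nonpositive because P(T) is positive semidefinite.  Hence each step of the
   algorithm turns T into a tree of no greater index that contains the extended forest; at the end
   of the run that tree is the Huffman tree. *)
Require Import Defs.
From HB Require Import structures.
From mathcomp Require Import all_boot all_order all_algebra perm.
From mathcomp Require Import zify ring lra.
Set Implicit Arguments. Unset Strict Implicit. Unset Printing Implicit Defensive.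
Import Order.TTheory GRing.Theory Num.Theory.
Local Open Scope ring_scope.

(** * Rooted trees and their distances *)

(** The root is its own parent; [x != y] discards the resulting loop. *)
Definition parent_rel (n : nat) (p : 'I_n -> 'I_n) : rel 'I_n :=
  fun x y => (x != y) && ((p x == y) || (p y == x)).

(** [dep] may be any function decreasing towards the root, not only the depth; this leaves freedom
    when branches are re-attached. *)
Definition rooted (n : nat) (r : 'I_n) (p : 'I_n -> 'I_n) : Prop :=
  p r = r /\ exists dep : 'I_n -> nat, forall x, x != r -> (dep (p x) < dep x)%N.

(* [fconnect p y x] reads: x is an ancestor of y or y itself. *)
Definition cutdist (n : nat) (p : 'I_n -> 'I_n) (i j : 'I_n) : nat :=
  (\sum_x (fconnect p i x (+) fconnect p j x))%N.

Lemma fconnect_step (T : finType) (f : T -> T) (y x : T) :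
  fconnect f y x = (x == y) || fconnect f (f y) x.
Proof.
apply/idP/orP => [yx|[/eqP->|fyx]]; last 2 first.
- exact: connect0.
- exact: connect_trans (fconnect1 f y) fyx.
case def_k: (findex f y x) (iter_findex yx) => [|k] /=; first by move=> ->; left.
by rewrite -iterS iterSr => <-; right; exact: fconnect_iter.
Qed.

Lemma parent_rel_sym n (p : 'I_n -> 'I_n) : symmetric (parent_rel p).
Proof. by move=> x y; rewrite /parent_rel eq_sym orbC. Qed.

Lemma parent_rel_irr n (p : 'I_n -> 'I_n) : irreflexive (parent_rel p).
Proof. by move=> x; rewrite /parent_rel eqxx. Qed.

Lemma sum_addb_pred1 (I : finType) (f g : I -> bool) (y : I) :
  (forall x, f x = g x (+) (x == y)) -> ~~ g y ->
  (\sum_x f x)%N = (\sum_x g x)%N.+1.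
Proof.
move=> fg gy; rewrite (bigD1 y)//= [in RHS](bigD1 y)//= fg eqxx (negPf gy) add0n add1n.
by congr _.+1; apply: eq_bigr => x /negPf xy; rewrite fg xy addbF.
Qed.

Section Rooted.
Variables (n : nat) (r : 'I_n) (p : 'I_n -> 'I_n).
Hypothesis rp : rooted r p.

Lemma rooted_root : p r = r. Proof. by case: rp. Qed.

Lemma rooted_ind (P : 'I_n -> Prop) :
  P r -> (forall x, x != r -> P (p x) -> P x) -> forall x, P x.
Proof.
case: rp => _ [dep dp] Pr IH x.
have [k] := ubnP (dep x); elim: k x => // k IHk x; rewrite ltnS => xk.
by have [->//|xr] := eqVneq x r; apply: IH => //; apply: IHk; apply: leq_trans (dp _ xr) xk.
Qed.

Lemma fconnect_root y : fconnect p y r.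
Proof. by elim/rooted_ind: y => [|y _ IH]; rewrite ?connect0// fconnect_step IH orbT. Qed.

Lemma root_fconnect x : fconnect p r x = (x == r).
Proof.
apply/idP/eqP => [rx|->]; last exact: connect0.
by rewrite -(iter_findex rx); elim: findex => //= k ->; exact: rooted_root.
Qed.

Lemma fconnect_parent y : y != r -> fconnect p (p y) y = false.
Proof.
case: rp => _ [dep dp] yr; apply/negP => yy.
have le k z : (dep (iter k p z) <= dep z)%N.
  elim: k => //= k IHk; apply: leq_trans IHk.
  have [->|xr] := eqVneq (iter k p z) r; first by rewrite rooted_root.
  exact: ltnW (dp _ xr).
have := le (findex p (p y) y) (p y); rewrite (iter_findex yy).
by rewrite leqNgt dp.
Qed.

(** Moving from a vertex to its parent crosses a single edge, so it toggles membership below [y]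
    alone. *)
Lemma fconnect_addb y x : y != r -> fconnect p y x (+) fconnect p (p y) x = (x == y).
Proof.
move=> yr; rewrite fconnect_step; have [->|//] /= := eqVneq x y.
  by rewrite fconnect_parent.
by rewrite addbb.
Qed.

Lemma fconnect_anti x y : fconnect p x y -> fconnect p y x -> x = y.
Proof.
move=> xy yx; have [xr|xr] := eqVneq x r.
  by move: xy; rewrite xr root_fconnect => /eqP.
apply/eqP; apply: contraT => nxy.
move: xy; rewrite fconnect_step eq_sym (negPf nxy) /= => pxy.
by rewrite -(fconnect_parent xr); apply: connect_trans pxy yx.
Qed.

Lemma cutdistC i j : cutdist p i j = cutdist p j i.
Proof. by apply: eq_bigr => x _; rewrite addbC. Qed.

Lemma cutdist_tri k i j : (cutdist p i j <= cutdist p i k + cutdist p k j)%N.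
Proof.
rewrite /cutdist -big_split /=; apply: leq_sum => x _.
by do 3 case: (fconnect _ _ _).
Qed.

Lemma cutdist_parent z y : y != r -> ~~ fconnect p z y ->
  cutdist p z y = (cutdist p z (p y)).+1.
Proof.
move=> yr zy; apply: (@sum_addb_pred1 _ _ _ y) => [x|]; last first.
  by rewrite (negPf zy) fconnect_parent.
by rewrite -(fconnect_addb x yr); do 3 case: (fconnect _ _ _).
Qed.

Lemma cutdist_eq0 i j : (cutdist p i j == 0)%N = (i == j).
Proof.
apply/idP/eqP => [|->]; last by rewrite /cutdist big1// => x _; rewrite addbb.
rewrite /cutdist sum_nat_eq0 => /forallP ij; apply: fconnect_anti.
  by have := ij j; rewrite /= connect0; case: (fconnect _ _ _).
by have := ij i; rewrite /= connect0; case: (fconnect _ _ _).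
Qed.

(** The root separates nothing, leaving at most [n - 1] separating vertices. This keeps the distance
    inside the range [iota 0 n] searched by [dist]. *)
Lemma cutdist_lt i j : (cutdist p i j < n)%N.
Proof.
have n0 : (0 < n)%N by exact: leq_ltn_trans (ltn_ord r).
rewrite -[X in (_ < X)%N](prednK n0) ltnS /cutdist (bigD1 r)//= !fconnect_root add0n.
rewrite -[n in n.-1]card_ord -(cardC1 r) -sum1_card.
by apply: leq_sum => x _; case: (_ (+) _).
Qed.

Lemma parent_neq y : y != r -> p y != y.
Proof. by move=> yr; apply/eqP => py; have := fconnect_parent yr; rewrite py connect0. Qed.

Lemma parent_rel_parent y : y != r -> parent_rel p y (p y).
Proof. by move=> yr; rewrite /parent_rel eqxx eq_sym parent_neq. Qed.

Lemma cutdist_edge x y : parent_rel p x y -> cutdist p x y = 1%N.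
Proof.
have E z : p z != z -> cutdist p z (p z) = 1%N.
  move=> pz; have zr : z != r by apply: contraNneq pz => ->; rewrite rooted_root.
  rewrite cutdistC cutdist_parent ?fconnect_parent//.
  by have /eqP-> : cutdist p (p z) (p z) == 0%N by rewrite cutdist_eq0.
case/andP=> xy /orP[/eqP pxy|/eqP pyx]; first by rewrite -pxy E// pxy eq_sym.
by rewrite -pyx cutdistC E// pyx.
Qed.

Variables (e : rel 'I_n).
Hypothesis ep : e =2 parent_rel p.

(** Each [x] other than the root stands for the edge to its parent, and this edge lies on the path
    from [i] to [j] exactly when one endpoint only is below [x]. The induction removes the last edge
    of the path, which enters [j] from its parent or from a child. *)
Lemma reach_cutdist k i j : reach e k i j = (cutdist p i j <= k)%N.
Proof.
elim: k j => [|k IHk] j /=; first by rewrite leqn0 cutdist_eq0.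
apply/orP/idP => [[|/existsP[m /andP[]]]|].
- by rewrite IHk => /leq_trans->.
- rewrite IHk ep => im /cutdist_edge mj.
  by apply: leq_trans (cutdist_tri m i j) _; rewrite mj addn1.
rewrite leq_eqVlt ltnS => /orP[/eqP ijk|]; last by rewrite -IHk; left.
right; apply/existsP.
have ij : i != j by rewrite -cutdist_eq0 ijk.
have [ij'|ij'] := boolP (fconnect p i j); last first.
  have jr : j != r by apply: contraNneq ij' => ->; exact: fconnect_root.
  exists (p j); rewrite IHk ep parent_rel_sym parent_rel_parent// andbT.
  by move: ijk; rewrite cutdist_parent// => -[->].
(* j is a proper ancestor of i: the neighbour of j towards i is a child of j. *)
have [c [pc cj ic]] : exists c, [/\ p c = j, c != j & fconnect p i c].
  clear IHk ijk; elim/rooted_ind: i ij ij' => [|i ir IH] ij.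
    by rewrite root_fconnect eq_sym (negPf ij).
  rewrite fconnect_step eq_sym (negPf ij) /= => pij.
  have [pj|pj] := eqVneq (p i) j; first by exists i; split; rewrite ?connect0.
  by have [c [pc cj ic]] := IH pj pij; exists c; rewrite fconnect_step ic orbT.
have cr : c != r by apply: contraNneq cj => c_r; rewrite -pc c_r rooted_root.
exists c; rewrite ep -pc parent_rel_parent// andbT IHk.
have: cutdist p i (p c) = (cutdist p i c).+1; last by rewrite pc ijk => -[->].
apply: (@sum_addb_pred1 _ _ _ c) => [x|]; last first.
  by rewrite ic connect0.
by rewrite -(fconnect_addb x cr); do 3 case: (fconnect _ _ _).
Qed.

Lemma dist_cutdist i j : dist e i j = cutdist p i j.
Proof.
rewrite /dist (eq_find (reach_cutdist ^~ i ^~ j)); set c := cutdist p i j.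
have cn : (c < n)%N := cutdist_lt i j.
rewrite -(subnKC (ltnW cn)) iotaD find_cat /= add0n.
rewrite ifF; last by apply/hasPn => k; rewrite mem_iota -ltnNge.
by rewrite size_iota; case: (n - c)%N (subn_gt0 c n) => [|k] /=; rewrite ?cn// leqnn addn0.
Qed.

End Rooted.

(** A neighbour with smaller distance from [r] serves as parent; the edge count then leaves room for
    no further edge. *)
Lemma tree_rooted n (e : rel 'I_n) (r : 'I_n) :
  is_tree e -> exists p, rooted r p /\ e =2 parent_rel p.
Proof.
case=> esym eirr econ ecard.
have reach_ex x : exists k, reach e k r x.
  have /connectP[s] := econ r x; elim/last_ind: s x => [|s y IHs] x.
    by move=> _ ->; exists 0%N => /=.
  rewrite rcons_path last_rcons => /andP[es ey] ->.
  have [k rk] := IHs _ es erefl; exists k.+1 => /=.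
  by apply/orP; right; apply/existsP; exists (last r s); rewrite rk.
pose dep x := ex_minn (reach_ex x).
have depP x : x != r -> exists y, e x y && (dep y < dep x)%N.
  rewrite /dep; case: (ex_minnP (reach_ex x)) => -[|k] /=.
    by move=> /eqP rx _ /eqP[].
  move=> /orP[xk xmin|/existsP[y /andP[yk eyx]] xmin] _.
    by have := xmin _ xk; rewrite ltnn.
  by exists y; rewrite esym eyx; case: ex_minnP => l _ /(_ _ yk); rewrite ltnS.
pose p x := if x == r then r else odflt r [pick y | e x y && (dep y < dep x)%N].
have pP x : x != r -> e x (p x) && (dep (p x) < dep x)%N.
  move=> xr; rewrite /p (negPf xr); case: pickP => [y //|/= none].
  by have [y] := depP x xr; rewrite none.
have rp : rooted r p.
  by split; [rewrite /p eqxx | exists dep => x /pP/andP[]].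
exists p; split=> // => x y.
(* The 2(n-1) oriented edges between a vertex and its parent are already all of them. *)
pose F1 := [set (z, p z) | z in [set~ r]]; pose F2 := [set (p z, z) | z in [set~ r]].
have cF1 : #|F1| = n.-1 by rewrite card_imset ?cardsC1 ?card_ord// => a b [].
have cF2 : #|F2| = n.-1 by rewrite card_imset ?cardsC1 ?card_ord// => a b [].
have dF : F1 :&: F2 = set0.
  apply/setP => -[a b]; rewrite !inE; apply/negP.
  move=> /andP[/imsetP[z + [-> ->]] /imsetP[t + [zt tz]]].
  rewrite !inE => zr tr; have /andP[_] := pP z zr; have /andP[_] := pP t tr.
  by rewrite -zt tz => /ltn_trans h /h; rewrite ltnn.
have FE : F1 :|: F2 = [set q | e q.1 q.2].
  apply/eqP; rewrite eqEcard ecard cardsU dF cards0 subn0 cF1 cF2 -subn1 addnn mul2n leqnn andbT.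
  apply/subsetP => q; rewrite !inE => /orP[] /imsetP[z]; rewrite !inE => zr -> /=.
    by have /andP[] := pP z zr.
  by rewrite esym; have /andP[] := pP z zr.
have -> : e x y = ((x, y) \in F1 :|: F2) by rewrite FE inE.
rewrite /parent_rel inE; apply/idP/idP.
  move=> /orP[] /imsetP[z]; rewrite !inE => zr [-> ->].
    by rewrite eqxx eq_sym (parent_neq rp).
  by rewrite eqxx orbT (parent_neq rp).
have nr z : p z != z -> z != r by apply: contraNneq => ->; rewrite (rooted_root rp).
move=> /andP[xy /orP[/eqP pxy|/eqP pyx]]; apply/orP; [left|right]; apply/imsetP.
  by exists x; rewrite ?pxy// !inE nr// pxy eq_sym.
by exists y; rewrite ?pyx// !inE nr// pyx.
Qed.

Lemma rooted_tree_with_degrees n (d : 'I_n -> nat) (r : 'I_n) p :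
  generating_degseq d -> rooted r p ->
  (forall i, deg (parent_rel p) i = d i) ->
  tree_with_degrees d (parent_rel p).
Proof.
move=> dsum rp degp; split=> //; split.
- exact: parent_rel_sym.
- exact: parent_rel_irr.
- have toroot i : connect (parent_rel p) i r.
    elim/(rooted_ind rp): i => [|i ir]; first exact: connect0.
    by apply: connect_trans; apply/connect1/(parent_rel_parent rp).
  move=> i j; apply: connect_trans (toroot i) _.
  by rewrite (sym_connect_sym (@parent_rel_sym _ p)).
rewrite -dsum -(eq_bigr _ (fun i _ => degp i)).
rewrite (eq_bigr (fun i => \sum_(j | parent_rel p i j) 1)%N) => [|i _].
  by rewrite pair_big_dep /= sum1dep_card.
by rewrite sum1dep_card.
Qed.

(** * Quadratic forms of the distance matrix *)

(** With signs marking the two sides of an edge, half of one minus their product indicates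
    separation. Signs linearize the cut structure, so quadratic forms become sums of squares. *)
Lemma natr_dist (R : realFieldType) n (e : rel 'I_n) r p i j :
  rooted r p -> e =2 parent_rel p ->
  (dist e i j)%:R
    = \sum_(x | x != r) (1 - (-1) ^+ fconnect p i x * (-1) ^+ fconnect p j x) / 2 :> R.
Proof.
move=> rp ep; rewrite (dist_cutdist rp ep) /cutdist (bigD1 r)//=.
rewrite !(fconnect_root rp) add0n natr_sum; apply: eq_bigr => x _.
by case: (fconnect p i x); case: (fconnect p j x); rewrite /= ?expr0 ?expr1; field.
Qed.

Lemma trace_Pmx_psd (R : realFieldType) n (e : rel 'I_n) (M : 'M[R]_n) :
  is_tree e -> psd M -> 0 <= \tr (Pmx R e *m M).
Proof.
move=> te psdM; have [r _|no] := pickP 'I_n; last first.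
  by rewrite /mxtrace big_pred0.
have [p [rp ep]] := tree_rooted r te.
pose s x : 'cV[R]_n := \col_i (-1) ^+ fconnect p i x.
(* There are [n - 1] vertices [x != r], so each edge takes a share 1/2 of the constant (n-1)/2,
   which cancels the 1/2 in its cut indicator. *)
have PE i j : Pmx R e i j = 2^-1 * \sum_(x | x != r) s x i 0 * s x j 0.
  rewrite !mxE (natr_dist R i j rp ep) mulr1.
  rewrite -[n in (n - 1)%N]card_ord subn1 -(cardC1 r) -sum1_card natr_sum mulr_suml -sumrB.
  by rewrite mulr_sumr; apply: eq_bigr => x _; rewrite !mxE; field.
have -> : \tr (Pmx R e *m M) = 2^-1 * \sum_(x | x != r) ((s x)^T *m M *m s x) 0 0.
  rewrite mulr_sumr (eq_bigr (fun x => \sum_i \sum_j 2^-1 * (s x i 0 * s x j 0) * M j i)).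
    rewrite [in RHS]exchange_big /=; apply: eq_bigr => i _; rewrite !mxE [in RHS]exchange_big /=.
    by apply: eq_bigr => j _; rewrite PE mulr_sumr mulr_suml.
  move=> x _; rewrite mxE mulr_sumr; apply: eq_bigr => i _.
  by rewrite mxE mulr_suml mulr_sumr; apply: eq_bigr => j _; rewrite [(s x)^T _ _]mxE; ring.
by rewrite mulr_ge0 ?invr_ge0 ?ler0n// sumr_ge0.
Qed.

(** The left side is the quadratic form of the distance matrix on the difference of the images of
    the weight [mu] under [a] and [b]. The total mass cancels, and each edge contributes -1/2 times
    a square. *)
Lemma dist_negative_type (R : realFieldType) n (e : rel 'I_n) (mu : 'I_n -> R)
    (a b : 'I_n -> 'I_n) : is_tree e ->
  \sum_y \sum_z mu y * mu z *
    ((dist e (a y) (a z))%:R + (dist e (b y) (b z))%:R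
     - (dist e (a y) (b z))%:R - (dist e (b y) (a z))%:R) <= 0.
Proof.
move=> te; have [r _|no] := pickP 'I_n; last by rewrite big_pred0.
have [p [rp ep]] := tree_rooted r te.
have [s dE] : exists s : 'I_n -> 'I_n -> R, forall i j,
    (dist e i j)%:R = \sum_(x | x != r) (1 - s x i * s x j) / 2.
  by exists (fun x i => (-1) ^+ fconnect p i x) => i j; exact: natr_dist.
rewrite (eq_bigr (fun y => \sum_z \sum_(x | x != r)
    (- 2^-1 * ((mu y * (s x (a y) - s x (b y))) * (mu z * (s x (a z) - s x (b z))))))); last first.
  move=> y _; apply: eq_bigr => z _; rewrite !dE -big_split -!sumrB mulr_sumr.
  by apply: eq_bigr => x _ /=; field.
under eq_bigr do rewrite exchange_big.
rewrite exchange_big /=; apply: sumr_le0 => x _.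
under eq_bigr do rewrite -mulr_sumr -mulr_sumr.
rewrite -mulr_sumr -mulr_suml -expr2 mulNr oppr_le0.
by rewrite mulr_ge0 ?sqr_ge0 ?invr_ge0 ?ler0n.
Qed.

Lemma distC n (e : rel 'I_n) i j : is_tree e -> dist e i j = dist e j i.
Proof.
by move=> te; have [p [rp ep]] := tree_rooted i te; rewrite !(dist_cutdist rp ep) cutdistC.
Qed.

(** Seen from [x], at most one neighbour of [v] is nearer than [v], and the others are one step
    farther. At [x = v] both are farther, whence the extra 2. *)
Lemma dist_convex n (e : rel 'I_n) x v a b : is_tree e ->
  e v a -> e v b -> a != b -> (2 * dist e x v + 2 * (x == v) <= dist e x a + dist e x b)%N.
Proof.
move=> te; have [p [rp ep]] := tree_rooted x te.
rewrite !ep !(dist_cutdist rp ep).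
have down c : c != x -> cutdist p x c = (cutdist p x (p c)).+1.
  by move=> cx; rewrite (cutdist_parent rp)// (root_fconnect rp).
have step c : parent_rel p v c -> (p v = c /\ v != x) \/ cutdist p x c = (cutdist p x v).+1.
  move=> /andP[vc /orP[/eqP pv|/eqP pc]].
    left; split=> //; apply: contraNneq vc => vx; rewrite vx (rooted_root rp) in pv.
    by rewrite vx pv.
  right; rewrite -pc; apply: down; apply: contraNneq vc => cx.
  by rewrite -pc cx (rooted_root rp).
move=> /step[[pa vx]|da] /step[[pb vx']|db]; first by rewrite -pa -pb eqxx.
- by rewrite db down// pa [x == v]eq_sym (negPf vx); lia.
- by rewrite da down// pb [x == v]eq_sym (negPf vx'); lia.
- by rewrite da db; case: (eqVneq x v) => [->|]; rewrite ?(cutdist_eq0 rp)//; lia.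
Qed.

Lemma wienerE (R : realFieldType) n (mu : 'cV[R]_n) (e : rel 'I_n) :
  wiener mu e = \sum_y \sum_z mu y 0 * mu z 0 * (dist e y z)%:R.
Proof.
rewrite /wiener mxE exchange_big /=; apply: eq_bigr => z _.
rewrite mxE mulr_suml; apply: eq_bigr => y _; rewrite !mxE; ring.
Qed.

(** * Trees containing the forest built by the algorithm *)

(* A state of the algorithm: the built forest is given by the parent map [up], and [rt y] is the
   root of its component; vertices outside [W] and [M] already have their final degree. *)
Record huff_inv (R : realFieldType) (n : nat) (d : 'I_n -> nat) (mu : 'I_n -> R)
    (W M : {set 'I_n}) (w : 'I_n -> R) (E : rel 'I_n) (up rt : 'I_n -> 'I_n) : Prop := {
  inv_disj : forall x, x \in W -> x \notin M;
  inv_up : forall x, x \in W :|: M -> up x = x;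
  inv_upM : forall x, x \notin M -> up x \notin M;
  inv_E : E =2 parent_rel up;
  inv_rt : forall x, x \in W :|: M -> rt x = x;
  inv_rtW : forall x, x \notin M -> rt x \in W;
  inv_rt_up : forall x, rt (up x) = rt x;
  inv_w : forall x, x \in W :|: M -> w x = \sum_(y | rt y == x) mu y;
  inv_deg : forall x, x \notin W :|: M -> deg E x = d x;
  inv_degW : forall x, x \in W -> (deg E x).+1 = d x;
  inv_degM : forall x, x \in M -> (1 < d x)%N
}.

Record skeletal (n : nat) (W M : {set 'I_n}) (up p : 'I_n -> 'I_n) : Prop := {
  skel_M : forall x, x \in M -> p x \in M;
  skel_W : forall x, x \in W -> p x \in M;
  skel_up : forall x, x \notin W :|: M -> p x = up x
}.

(** The vertex of [M] from which the component of [y] hangs. *)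
Definition anchor (n : nat) (M : {set 'I_n}) (rt p : 'I_n -> 'I_n) (y : 'I_n) : 'I_n :=
  if rt y \in M then rt y else p (rt y).

(** The part of the path outside the subtree spanned by [M]. It depends on the forest alone, hence
    is common to all trees containing it. *)
Definition inner_dist (n : nat) (M : {set 'I_n}) (up : 'I_n -> 'I_n) (y z : 'I_n) : nat :=
  (\sum_(x | x \notin M)
     (((y \notin M) && fconnect up y x) (+) ((z \notin M) && fconnect up z x)))%N.

Section State.
Variables (R : realFieldType) (n : nat) (d : 'I_n -> nat) (mu : 'I_n -> R).
Variables (W M : {set 'I_n}) (w : 'I_n -> R) (E : rel 'I_n) (up rt : 'I_n -> 'I_n).
Hypothesis inv : huff_inv d mu W M w E up rt.

Lemma inv_dead_M x : x \notin W :|: M -> x \notin M.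
Proof. by rewrite inE negb_or => /andP[]. Qed.

Lemma inv_ME u z : u \in M -> E u z = false.
Proof.
move=> uM; rewrite (inv_E inv) /parent_rel (inv_up inv) ?inE ?uM ?orbT//.
have [->//|uz] /= := eqVneq u z; apply/eqP => upz.
have [zM|zM] := boolP (z \in M); last by have := inv_upM inv zM; rewrite upz uM.
by move: uz; rewrite -upz (inv_up inv) ?eqxx// inE zM orbT.
Qed.

(** An internal vertex absorbs nothing before it is picked; so monotonicity of [mu] passes to the
    current weights on [M]. *)
Lemma inv_wM u : u \in M -> w u = mu u.
Proof.
move=> uM; rewrite (inv_w inv) ?inE ?uM ?orbT// (big_pred1 u)// => y /=.
have [yM|yM] := boolP (y \in M); first by rewrite (inv_rt inv)// inE yM orbT.
apply/eqP/eqP => [rty|yu]; last by rewrite yu uM in yM.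
by have := inv_disj inv (inv_rtW inv yM); rewrite rty uM.
Qed.

Lemma sum_rt (g : 'I_n -> R) :
  \sum_y mu y * g (rt y) = \sum_(x in M) w x * g x + \sum_(x in W) w x * g x.
Proof.
have rtWM y : rt y \in W :|: M.
  rewrite inE; have [yM|yM] := boolP (y \in M); last by rewrite (inv_rtW inv).
  by rewrite (inv_rt inv) ?yM ?inE ?yM orbT.
transitivity (\sum_(x in W :|: M) w x * g x); last first.
  rewrite (bigID (mem M)) /=; congr (_ + _); apply: eq_bigl => x; rewrite !inE.
    by case: (x \in M); rewrite ?orbT ?andbF.
  by case xW: (x \in W); rewrite /= ?andbN// (inv_disj inv xW).
rewrite (partition_big rt (mem (W :|: M))) //=; apply: eq_bigr => x xWM.
by rewrite (inv_w inv)// mulr_suml; apply: eq_bigr => y /eqP->.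
Qed.

Section Skeleton.
Variables (v : 'I_n) (p : 'I_n -> 'I_n).
Hypotheses (vM : v \in M) (rp : rooted v p) (sp : skeletal W M up p).

Lemma anchorM y : anchor M rt p y \in M.
Proof.
rewrite /anchor; case: ifP => // rtM.
apply: (skel_W sp); apply: (inv_rtW inv); apply: contraFN rtM => yM.
by rewrite (inv_rt inv)// inE yM orbT.
Qed.

Lemma anchor_id u : u \in M -> anchor M rt p u = u.
Proof. by move=> uM; rewrite /anchor (inv_rt inv) ?uM// inE uM orbT. Qed.

Lemma fconnect_out y x : x \notin M -> fconnect p y x = (y \notin M) && fconnect up y x.
Proof.
move=> xM; elim/(rooted_ind rp): y => [|y yv IH].
  by rewrite vM (root_fconnect rp); apply: contraNF xM => /eqP->.
have [yM|yM] /= := boolP (y \in M).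
  rewrite fconnect_step IH (skel_M sp)// orbF.
  by apply: contraNF xM => /eqP->.
have [yW|yW] := boolP (y \in W).
  rewrite fconnect_step IH (skel_W sp)//= orbF.
  have upy : up y = y by rewrite (inv_up inv)// inE yW.
  apply/eqP/idP => [->|yx]; first exact: connect0.
  by rewrite -(iter_findex yx); elim: (findex _ _ _) => //= k ->; rewrite upy.
have yd : y \notin W :|: M by rewrite inE negb_or yW.
rewrite fconnect_step IH (skel_up sp)// (inv_upM inv)//=.
by rewrite [RHS]fconnect_step.
Qed.

Lemma fconnect_anchor y x : x \in M -> fconnect p y x = fconnect p (anchor M rt p y) x.
Proof.
move=> xM; elim/(rooted_ind rp): y => [|y yv IH]; first by rewrite anchor_id.
have [yM|yM] := boolP (y \in M); first by rewrite anchor_id.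
rewrite fconnect_step; have [xy|_] /= := eqVneq x y; first by rewrite -xy xM in yM.
rewrite IH; have [yW|yW] := boolP (y \in W).
  rewrite anchor_id ?(skel_W sp)// /anchor (inv_rt inv) ?inE ?yW//.
  by rewrite (negPf yM).
by rewrite (skel_up sp) ?inE ?negb_or ?yW// /anchor (inv_rt_up inv).
Qed.

(** Cuts at vertices outside [M] see only the forest; cuts at vertices of [M] see [y] and [z] only
    through their anchors. *)
Lemma cutdist_anchor y z :
  cutdist p y z =
  (inner_dist M up y z + cutdist p (anchor M rt p y) (anchor M rt p z))%N.
Proof.
rewrite /cutdist (bigID (mem M)) /= addnC; congr (_ + _)%N.
  by apply: eq_bigr => x xM; rewrite !fconnect_out.
rewrite [RHS](bigID (mem M)) /= [X in (_ + X)%N]big1 ?addn0.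
  by apply: eq_bigr => x xM; rewrite (fconnect_anchor y xM) (fconnect_anchor z xM).
by move=> x xM; rewrite !fconnect_out// !anchorM.
Qed.

End Skeleton.

Section Tree.
Variables (T : rel 'I_n) (v : 'I_n) (p : 'I_n -> 'I_n).
Hypotheses (degT : forall i, deg T i = d i) (ET : forall x y, E x y -> T x y).
Hypotheses (vM : v \in M) (rp : rooted v p) (Tp : T =2 parent_rel p).

Lemma dead_edges x z : x \notin W :|: M -> T x z = E x z.
Proof.
move=> xd; have /eqP: [set z | E x z] == [set z | T x z].
  rewrite eqEcard -!/(deg _ _) degT (inv_deg inv)// leqnn andbT.
  by apply/subsetP => y; rewrite !inE; exact: ET.
by move=> /setP/(_ z); rewrite !inE.
Qed.

Lemma free_edge x z t : x \in W -> T x z -> ~~ E x z -> T x t -> ~~ E x t -> z = t.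
Proof.
move=> xW Tz Ez Tt Et.
have c1 : #|[set z | T x z] :\: [set z | E x z]| == 1%N.
  rewrite cardsD (setIidPr _).
    by rewrite -!/(deg _ _) degT -(inv_degW inv xW) subSnn.
  by apply/subsetP => y; rewrite !inE; exact: ET.
case/cards1P: c1 => q /setP c1.
have := c1 z; have := c1 t; rewrite !inE Tz Tt Ez Et /=.
by move=> /esym/eqP-> /esym/eqP->.
Qed.

(** Degrees force the shape: a finished vertex has no edge outside the forest, and a vertex of [W]
    has exactly one. *)
Lemma tree_skeletal : skeletal W M up p.
Proof.
have root_neq x : x \notin M -> x != v by apply: contraNneq => ->.
(* The forest edge to [p x] could otherwise only be directed from [p x] to [x]; then the induction
   hypothesis gives [p (p x) = x], a cycle. *)
have dead x : x \notin W :|: M -> p x = up x.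
  elim/(rooted_ind rp): x => [|x xv IH] xd; first by rewrite inE vM orbT in xd.
  have : E x (p x) by rewrite -dead_edges// Tp (parent_rel_parent rp).
  rewrite (inv_E inv) => /andP[_ /orP[/eqP->//|/eqP upx]].
  have pxM : p x \notin M.
    apply/negP => pM; have xp : up (p x) = p x by rewrite (inv_up inv)// inE pM orbT.
    rewrite upx in xp.
    by have := parent_neq rp xv; rewrite -xp eqxx.
  have pxd : p x \notin W :|: M.
    apply/negP => /(inv_up inv); rewrite upx => xp.
    by have := parent_neq rp xv; rewrite -xp eqxx.
  have := IH pxd; rewrite upx => ppx.
  by have := fconnect_parent rp xv; rewrite fconnect_step ppx connect0 orbT.
have Wnot x : x \in W -> ~~ E x (p x).
  move=> xW; have xv := root_neq _ (inv_disj inv xW).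
  apply/negP; rewrite (inv_E inv) => /andP[xpx].
  rewrite (inv_up inv) ?inE ?xW// (negPf xpx) /= => /eqP upx.
  have pxd : p x \notin W :|: M.
    by apply/negP => /(inv_up inv); rewrite upx => xp; rewrite -xp eqxx in xpx.
  have := dead _ pxd; rewrite upx => ppx.
  by have := fconnect_parent rp xv; rewrite fconnect_step ppx connect0 orbT.
(* The only non-forest edge at [x] leads to its parent, so edges to its children are forest
   edges. *)
have to_W x y : p y = x -> y != v -> x \in W -> E x y.
  move=> pyx yv xW; apply: contraT => Exy.
  have xv := root_neq _ (inv_disj inv xW).
  have Txp : T x (p x) by rewrite Tp (parent_rel_parent rp).
  have Txy : T x y by rewrite Tp parent_rel_sym -pyx (parent_rel_parent rp).
  have := free_edge xW Txp (Wnot _ xW) Txy Exy => ppy.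
  by have := fconnect_parent rp yv; rewrite fconnect_step pyx ppy connect0 orbT.
have par_M y : y \in W :|: M -> (y \in W) || (y != v) -> p y \in M.
  move=> yWM yv.
  have [->|{}yv] := eqVneq y v; first by rewrite (rooted_root rp).
  have Ey : ~~ E y (p y).
    by move: yWM; rewrite inE => /orP[/Wnot//|yM]; rewrite inv_ME.
  apply: contraT => pM; have [pW|pW] := boolP (p y \in W).
    by move: Ey; rewrite (inv_E inv) parent_rel_sym -(inv_E inv) to_W.
  have pd : p y \notin W :|: M by rewrite inE negb_or pW.
  move: Ey; rewrite (inv_E inv) parent_rel_sym -(inv_E inv) -dead_edges//.
  by rewrite Tp parent_rel_sym (parent_rel_parent rp).
split=> // x xM; last by apply: par_M; rewrite ?inE xM.
have [->|xv] := eqVneq x v; first by rewrite (rooted_root rp).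
by apply: par_M; rewrite ?inE ?xM ?xv orbT.
Qed.

End Tree.
End State.

(** * The exchange step *)

(** A rearrangement argument: while some [s] in [S] is not at [v], it trades places with a [t]
    outside [S] that is; once all of [S] is at [v], the surplus there moves to [m]. Neither move
    raises the sum, since [psi] is largest at [v] and [S] is lightest. *)
Lemma reassign (I J : finType) (R : realFieldType) (W S : {set I}) (M : {set J})
    (a : I -> J) (w : I -> R) (psi : J -> R) (v m : J) (l : nat) :
  S \subset W -> m \in M ->
  (forall x, x \in W -> a x \in M) -> (forall x, x \in W -> 0 <= w x) ->
  (forall s t, s \in S -> t \in W :\: S -> w s <= w t) ->
  (forall u, u \in M -> psi u <= psi v) ->
  #|[set x in W | a x == v]| = l -> (#|S| <= l)%N -> (m = v -> #|S| = l) ->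
  exists q : I -> J,
    [/\ forall x, x \in W -> q x \in M, forall s, s \in S -> q s = v,
        forall u, u != v -> #|[set x in W | q x == u]| =
          (#|[set x in W | a x == u]| + (if u == m then l - #|S| else 0))%N,
        #|[set x in W | q x == v]| = #|S|
      & \sum_(x in W) w x * psi (q x) <= \sum_(x in W) w x * psi (a x)].
Proof.
move=> SW mM + w0 wS psiv.
have [k] := ubnP #|S :\: [set x in W | a x == v]|.
elim: k a => // k IHk a; set L := [set x in W | a x == v] => SLk aM Ll Sl mv.
have [SL|/subsetPn[s sS sL]] := boolP (S \subset L).
  have [mv'|nmv] := eqVneq m v.
    have SL' : S = L by apply/eqP; rewrite eqEcard SL Ll (mv mv') leqnn.
    exists a; split=> //.
    - by move=> s; rewrite SL' inE => /andP[_ /eqP].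
    - by move=> u uv; rewrite mv' (negPf uv) addn0.
    - by rewrite -/L SL'.
  exists (fun x => if x \in L :\: S then m else a x); split.
  - by move=> x xW; case: ifP => // _; exact: aM.
  - by move=> s sS; rewrite inE sS /=; have := subsetP SL s sS; rewrite inE => /andP[_ /eqP].
  - move=> u uv; have [->|um] := eqVneq u m; last first.
      rewrite addn0; apply: eq_card => x; rewrite !inE.
      case xW: (x \in W) => //=; case: ifP => [/andP[_ /eqP->]|//].
      by rewrite eq_sym (negPf um) eq_sym (negPf uv).
    have -> : [set x in W | (if x \in L :\: S then m else a x) == m]
            = [set x in W | a x == m] :|: (L :\: S).
      apply/setP => x; rewrite !inE.
      case xW: (x \in W); rewrite ?andbF//=.
      by case: ifP; rewrite ?eqxx ?orbT ?orbF.
    rewrite cardsU cardsD (setIidPr SL) Ll [X in (_ - #|pred_of_set X|)%N](_ : _ = set0)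
      ?cards0 ?subn0//.
    apply/setP => x; rewrite !inE; apply/negP => /andP[/andP[_ /eqP->]].
    by rewrite (negPf nmv) !andbF.
  - apply: eq_card => x; rewrite !inE.
    case xW: (x \in W) => /=; last by apply/esym/negP => /(subsetP SW); rewrite xW.
    have [xS|xS] /= := boolP (x \in S).
      by have := subsetP SL x xS; rewrite inE => /andP[].
    by case: ifP => [_|->//]; rewrite (negPf nmv).
  - apply: ler_sum => x xW; case: ifP => [|//].
    rewrite !inE => /andP[_ /andP[_ /eqP->]]; apply: ler_wpM2l; [exact: w0|exact: psiv].
(* If [L] lay inside [S], the bound on [#|S|] would force [L = S], contrary to [s]. *)
have [t tL tS] : exists2 t, t \in L & t \notin S.
  apply/subsetPn; apply: contra sL => LS.
  by have /eqP-> : L == S by rewrite eqEcard LS Ll.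
have st : s != t by apply: contraNneq tS => <-.
have [sW tW] : s \in W /\ t \in W.
  by split; [exact: (subsetP SW)|move: tL; rewrite inE => /andP[]].
have tv : a t = v by move: tL; rewrite inE => /andP[_ /eqP].
have tpW x : (tperm s t x \in W) = (x \in W).
  by case: tpermP => [->|->|//]; rewrite ?sW ?tW.
pose a' x := a (tperm s t x).
have card_a' u : #|[set x in W | a' x == u]| = #|[set x in W | a x == u]|.
  rewrite -[RHS](card_preimset _ (@perm_inj _ (tperm s t))).
  by apply: eq_card => x; rewrite !inE tpW.
have := IHk a'; case.
- rewrite ltnS in SLk; apply: leq_trans SLk.
  rewrite (cardsD1 s (S :\: L)) in_setD sS sL add1n ltnS.
  apply/subset_leq_card/subsetP => x; rewrite !inE => /andP[xL xS].
  have xs : x != s by apply: contraNneq xL => ->; rewrite sW /a' tpermL tv eqxx.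
  have xt : x != t by apply: contraNneq tS => <-.
  by rewrite xs xS andbT; move: xL; rewrite /a' tpermD// eq_sym.
- by move=> x xW; rewrite /a' aM// tpW.
- by rewrite card_a'.
- exact: Sl.
- exact: mv.
move=> q [qM qS qcard qv qle]; exists q; split=> //.
  by move=> u uv; rewrite qcard// card_a'.
apply: le_trans qle _.
rewrite (bigD1 s)//= (bigD1 t)/=; last by rewrite tW eq_sym.
rewrite [leRHS](bigD1 s)//= [X in _ <= _ + X](bigD1 t)/=; last by rewrite tW eq_sym.
rewrite !addrA lerD//.
  (* The trade lowers the sum by [(w t - w s) * (psi v - psi (a s))], which is nonnegative. *)
  rewrite /a' tpermL tpermR tv.
  have := wS s t sS; rewrite inE tS tW => /(_ isT) wst; have := psiv _ (aM s sW).
  by move=> h; nra.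
by apply: ler_sum => x /andP[/andP[_ xs] xt]; rewrite /a' tpermD// eq_sym.
Qed.

(* Maximality of the transmission makes [v] pendant in the subtree spanned by [M]; the unweighted
   transmission breaks ties, since [mu] may vanish. *)
Lemma exists_center (R : realFieldType) n (e : rel 'I_n) (mu : 'I_n -> R)
    (M : {set 'I_n}) (m : 'I_n) :
  is_tree e -> (forall x, 0 <= mu x) -> m \in M ->
  exists v, [/\ v \in M,
    forall u, u \in M -> \sum_z mu z * (dist e u z)%:R <= \sum_z mu z * (dist e v z)%:R
    & forall a b, a \in M -> b \in M -> e v a -> e v b -> a = b].
Proof.
move=> te mu0 mM; pose phi u := \sum_z mu z * (dist e u z)%:R.
pose tau u := (\sum_z dist e u z)%N.
have [v0 v0M v0max] := arg_maxP (P := mem M) phi mM.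
pose M0 := [pred u | (u \in M) && (phi u == phi v0)].
have v0M0 : M0 v0 by rewrite /= eqxx andbT.
have [v /andP[vM /eqP vphi] vmax] := arg_maxnP tau v0M0.
have phimax u : u \in M -> phi u <= phi v by move=> uM; rewrite vphi; exact: v0max.
exists v; split=> // a b aM bM eva evb; apply/eqP/negPn/negP => ab.
have conv x : (2 * dist e v x + 2 * (x == v) <= dist e a x + dist e b x)%N.
  by rewrite (distC v x) // (distC a x) // (distC b x) //; exact: dist_convex.
have phi2 : phi v + phi v <= phi a + phi b.
  rewrite -!big_split /=; apply: ler_sum => z _; rewrite -!mulrDr ler_wpM2l// -!natrD ler_nat.
  by rewrite addnn -mul2n; apply: leq_trans (leq_addr _ _) (conv z).
have pa := phimax a aM; have pb := phimax b bM.
(* Convexity together with maximality makes [a] and [b] maximizers of [phi] as well, so they compete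
   for [tau]; there the term at [v] gives a strict excess of 2. *)
have ta : (tau a <= tau v)%N by apply: vmax; rewrite /= aM -vphi; apply/eqP; lra.
have tb : (tau b <= tau v)%N by apply: vmax; rewrite /= bM -vphi; apply/eqP; lra.
have : (2 * tau v + 2 <= tau a + tau b)%N; last first.
  move=> /leq_trans/(_ (leq_add ta tb)).
  by rewrite addnn -mul2n -[leqRHS]addn0 leq_add2l.
rewrite -!big_split /= big_distrr /= (bigD1 v)//= [leqRHS](bigD1 v)//= addnAC.
apply: leq_add.
  by have := conv v; rewrite eqxx muln1.
by apply: leq_sum => z _; exact: leq_trans (leq_addr _ _) (conv z).
Qed.

Lemma deg_rooted n r (p : 'I_n -> 'I_n) i : rooted r p ->
  deg (parent_rel p) i = (#|[set y | (y != r) && (p y == i)]| + (i != r))%N.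
Proof.
move=> rp; rewrite /deg; set C := [set y | _ && _].
have nC y : p y == i -> y != i -> y \in C.
  move=> pyi yi; rewrite inE pyi andbT; apply: contraNneq yi => yr.
  by rewrite -(eqP pyi) yr (rooted_root rp).
have Ci : i \notin C.
  by rewrite inE; apply/negP => /andP[ir]; rewrite (negPf (parent_neq rp ir)).
have [ir|ir] := eqVneq i r.
  rewrite addn0; apply: eq_card => y; rewrite inE /parent_rel.
  apply/andP/idP => [[iy /orP[/eqP piy|pyi]]|yC].
  - by move: iy; rewrite -piy ir (rooted_root rp) eqxx.
  - by apply: nC; rewrite // eq_sym.
  - split; first by apply: contraNneq Ci => ->.
    by move: yC; rewrite inE => /andP[_ ->]; rewrite orbT.
have pC : p i \notin C.
  rewrite inE; apply/negP => /andP[_ /eqP ppi].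
  by have := fconnect_parent rp ir; rewrite fconnect_step ppi connect0 orbT.
rewrite addnC -(_ : #|p i |: C| = (1 + #|C|)%N); last by rewrite cardsU1 pC.
apply: eq_card => y; rewrite in_setU1 inE /parent_rel [p i == y]eq_sym.
apply/andP/orP => [[iy /orP[->|pyi]]|[/eqP->|yC]]; [by left| right |split|split].
- by apply: nC; rewrite // eq_sym.
- by rewrite eq_sym (parent_neq rp).
- by rewrite eqxx.
- by apply: contraNneq Ci => ->.
- by move: yC; rewrite inE => /andP[_ ->]; rewrite orbT.
Qed.

Lemma exists_child n v (p : 'I_n -> 'I_n) (M : {set 'I_n}) : rooted v p ->
  (forall x, x \in M -> p x \in M) -> (1 < #|M|)%N -> v \in M ->
  exists z, [/\ z \in M, z != v & p z = v].
Proof.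
move=> rp pM M1 vM.
have : (0 < #|M :\ v|)%N by rewrite (cardsD1 v) vM in M1.
move=> /card_gt0P[u]; rewrite !inE => /andP[uv uM].
elim/(rooted_ind rp): u uv uM => [|x xv IH _ xM]; first by rewrite eqxx.
have [pxv|pxv] := eqVneq (p x) v; first by exists x.
exact: IH pxv (pM _ xM).
Qed.

(* The skeleton of [p] with the labels [v] and [m] swapped, each vertex [x] of [W] being
   re-attached at the position that [q x] has in [p]. *)
Definition relabel (n : nat) (W M : {set 'I_n}) (up p q : 'I_n -> 'I_n) (v m y : 'I_n) : 'I_n :=
  if y \in M then tperm v m (p (tperm v m y))
  else if y \in W then tperm v m (q y) else up y.

Lemma tperm_eq (I : finType) (v m x y : I) : (tperm v m x == y) = (x == tperm v m y).
Proof. by rewrite -(inj_eq (@perm_inj _ (tperm v m))) tpermK. Qed.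

(** * Shape, distances and degrees of the relabelled tree *)

Section Relabel.
Variables (R : realFieldType) (n : nat) (d : 'I_n -> nat) (mu : 'I_n -> R).
Variables (W M : {set 'I_n}) (w : 'I_n -> R) (E : rel 'I_n) (up rt : 'I_n -> 'I_n).
Hypothesis inv : huff_inv d mu W M w E up rt.
Variables (v m : 'I_n) (p q : 'I_n -> 'I_n).
Hypotheses (vM : v \in M) (mM : m \in M) (rp : rooted v p) (sp : skeletal W M up p).
Hypothesis qM : forall x, x \in W -> q x \in M.

Notation p' := (relabel W M up p q v m).
Notation s := (tperm v m).

Lemma relabel_permM x : (s x \in M) = (x \in M).
Proof. by case: tpermP => [->|->|//]; rewrite ?vM ?mM. Qed.

Lemma relabelM x : x \in M -> p' x = s (p (s x)).
Proof. by rewrite /relabel => ->. Qed.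

Lemma relabelW x : x \in W -> p' x = s (q x).
Proof. by move=> xW; rewrite /relabel xW (negPf (inv_disj inv xW)). Qed.

Lemma relabel_skeletal : skeletal W M up p'.
Proof.
split=> x.
- by move=> xM; rewrite relabelM// relabel_permM (skel_M sp)// relabel_permM.
- by move=> xW; rewrite relabelW// relabel_permM qM.
- by rewrite inE negb_or /relabel => /andP[/negPf-> /negPf->].
Qed.

Lemma relabel_rooted : rooted m p'.
Proof.
split; first by rewrite relabelM// tpermR (rooted_root rp) tpermL.
case: rp => pv [dep dp].
(* The shift by [N] puts everything outside [M] deeper than all of [M], wherever the branches are
   re-attached. *)
pose N := (\max_x dep x).+1.
have depN x : (dep x < N)%N by rewrite ltnS leq_bigmax.
exists (fun y => if y \in M then dep (s y) else N + dep y)%N => x xm.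
have [xM|xM] := boolP (x \in M).
  rewrite (skel_M relabel_skeletal)// relabelM// tpermK dp//.
  by rewrite tperm_eq tpermL.
have xv : x != v by apply: contraNneq xM => ->.
have [xW|xW] := boolP (x \in W).
  by rewrite (skel_W relabel_skeletal)//; apply: leq_trans (depN _) (leq_addr _ _).
have xd : x \notin W :|: M by rewrite inE negb_or xW.
rewrite (skel_up relabel_skeletal)// (negPf (inv_upM inv xM)) ltn_add2l.
by rewrite -(skel_up sp xd) dp.
Qed.

Lemma fconnect_relabel u x : u \in M -> fconnect p' u x = fconnect p (s u) (s x).
Proof.
elim/(rooted_ind relabel_rooted): u => [_|u um IH uM].
  by rewrite (root_fconnect relabel_rooted) tpermR (root_fconnect rp) tperm_eq tpermL.
rewrite fconnect_step IH ?(skel_M relabel_skeletal)// [RHS]fconnect_step.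
by rewrite relabelM// tpermK (inj_eq (@perm_inj _ s)).
Qed.

Lemma cutdist_relabel u z : u \in M -> z \in M -> cutdist p' u z = cutdist p (s u) (s z).
Proof.
move=> uM zM; rewrite /cutdist [RHS](reindex_inj (@perm_inj _ s)).
by apply: eq_bigr => x _; rewrite !fconnect_relabel.
Qed.

Lemma deg_skeletal r p0 u : rooted r p0 -> r \in M -> skeletal W M up p0 -> u \in M ->
  deg (parent_rel p0) u =
  (#|[set y in M | (y != r) && (p0 y == u)]| + #|[set x in W | p0 x == u]| + (u != r))%N.
Proof.
move=> r0 rM s0 uM; rewrite (deg_rooted _ r0); congr (_ + _)%N.
rewrite -(cardsID M [set y | (y != r) && (p0 y == u)]); congr (_ + _)%N;
  apply: eq_card => y; rewrite !inE.
  by rewrite andbC.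
have [yM|yM] /= := boolP (y \in M).
  by apply/esym/negP => /andP[/(inv_disj inv)]; rewrite yM.
have -> /= : y != r by apply: contraNneq yM => ->.
have [//|yW] /= := boolP (y \in W).
apply/negP => /eqP pyu; have := inv_upM inv yM.
by rewrite -(skel_up s0) ?inE ?negb_or ?yW// pyu uM.
Qed.

(** The position [tperm v m u] keeps its neighbours in the skeleton, and only its branches in [W]
    change from [p] to [q]. The additive form avoids truncated subtraction. *)
Lemma deg_relabel_in u : u \in M ->
  (deg (parent_rel p') u + #|[set x in W | p x == s u]|)%N =
  (deg (parent_rel p) (s u) + #|[set x in W | q x == s u]|)%N.
Proof.
move=> uM; rewrite (deg_skeletal relabel_rooted mM relabel_skeletal)//.
rewrite (deg_skeletal rp vM sp) ?relabel_permM//.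
have -> : (u != m) = (s u != v) by rewrite tperm_eq tpermL.
have -> : #|[set x in W | p' x == u]| = #|[set x in W | q x == s u]|.
  apply: eq_card => x; rewrite !inE; have [xW|//] := boolP (x \in W).
  by rewrite relabelW//= tperm_eq.
have -> : #|[set y in M | (y != m) && (p' y == u)]|
        = #|[set y in M | (y != v) && (p y == s u)]|.
  rewrite -[RHS](card_preimset _ (@perm_inj _ s)); apply: eq_card => y.
  rewrite !inE relabel_permM; have [yM|//] /= := boolP (y \in M).
  by rewrite relabelM// !tperm_eq tpermL.
by rewrite addnAC [RHS]addnAC; congr (_ + _)%N; rewrite addnAC.
Qed.

Lemma deg_relabel_out u : u \notin M -> deg (parent_rel p') u = deg (parent_rel p) u.
Proof.
move=> uM; rewrite (deg_rooted _ relabel_rooted) (deg_rooted _ rp).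
have ne z : z \in M -> u != z by move=> zM; apply: contraNneq uM => ->.
rewrite !ne//; congr (_ + _)%N; apply: eq_card => y; rewrite !inE.
have [yWM|yd] := boolP (y \in W :|: M).
  have pM : p y \in M.
    by move: yWM; rewrite inE => /orP[/(skel_W sp)|/(skel_M sp)].
  have p'M : p' y \in M.
    by move: yWM; rewrite inE => /orP[/(skel_W relabel_skeletal)|/(skel_M relabel_skeletal)].
  by rewrite ![_ == u]eq_sym !(negPf (ne _ _))// !andbF.
rewrite (skel_up sp yd) (skel_up relabel_skeletal yd).
have nz z : z \in M -> y != z by move=> zM; apply: contraNneq (inv_dead_M yd) => ->.
by rewrite !nz.
Qed.

Lemma parent_rel_relabel (S : {set 'I_n}) x y :
  S \subset W -> (forall z, z \in S -> q z = v) -> add_star E m S x y -> parent_rel p' x y.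
Proof.
move=> SW qS.
have starS z : z \in S -> parent_rel p' z m.
  move=> zS; have zW := subsetP SW z zS.
  rewrite /parent_rel relabelW// qS// tpermL eqxx andbT.
  by apply: contraTneq zW => ->; apply: contraL mM; exact: (inv_disj inv).
have upE z : z != up z -> parent_rel p' z (up z).
  move=> zup; have zd : z \notin W :|: M by apply: contraNN zup => /(inv_up inv)->.
  by rewrite /parent_rel zup (skel_up relabel_skeletal zd) eqxx.
move=> /or3P[|/andP[/eqP-> yS]|/andP[/eqP-> xS]]; last exact: starS.
  rewrite (inv_E inv) => /andP[xy /orP[/eqP xu|/eqP yu]].
    by rewrite -xu upE// xu.
  by rewrite parent_rel_sym -yu upE// yu eq_sym.
by rewrite parent_rel_sym starS.
Qed.

End Relabel.

Lemma exchange (R : realFieldType) n (d : 'I_n -> nat) (mu : 'I_n -> R)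
    (W M : {set 'I_n}) (w : 'I_n -> R) (E T : rel 'I_n) up rt (m : 'I_n) (S : {set 'I_n}) :
  generating_degseq d -> (forall x, 0 <= mu x) ->
  huff_inv d mu W M w E up rt ->
  (forall i j, i \in M -> j \in M -> (d i < d j)%N -> w i <= w j) ->
  tree_with_degrees d T -> (forall x y, E x y -> T x y) ->
  (1 < #|M|)%N -> m \in M ->
  (forall m', m' \in M -> w m <= w m') ->
  (forall m', m' \in M -> w m' = w m -> (d m <= d m')%N) ->
  S \subset W -> #|S| = (d m).-1 ->
  (forall s t, s \in S -> t \in W :\: S -> w s <= w t) ->
  exists T', [/\ tree_with_degrees d T', forall x y, add_star E m S x y -> T' x y
    & \sum_y \sum_z mu y * mu z * (dist T' y z)%:R
      <= \sum_y \sum_z mu y * mu z * (dist T y z)%:R].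
Proof.
move=> dsum mu0 inv mono [treeT degT] ET M1 mM mmin mtie SW cS wS.
have [v [vM vmax vpend]] := exists_center treeT mu0 mM.
have [p [rp Tp]] := tree_rooted v treeT.
have sp := tree_skeletal inv degT ET vM rp Tp.
have degp i : deg (parent_rel p) i = d i.
  by rewrite -degT; apply: eq_card => j; rewrite !inE Tp.
pose A := anchor M rt p.
have AM y : A y \in M by exact: (anchorM inv sp).
(* The transmission with every weight moved to its anchor. On [M] it differs from the true one by a
   constant, so [v] maximizes it too. *)
pose psi u := \sum_z mu z * (dist T u (A z))%:R.
have phi_psi u : u \in M -> \sum_z mu z * (dist T u z)%:R
    = psi u + \sum_z mu z * (inner_dist M up v z)%:R.
  move=> uM; rewrite -big_split; apply: eq_bigr => z _ /=; rewrite -mulrDr -natrD.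
  rewrite !(dist_cutdist rp Tp) (cutdist_anchor inv vM rp sp) (anchor_id inv _ uM).
  by rewrite addnC /inner_dist uM vM.
have psimax u : u \in M -> psi u <= psi v.
  by move=> uM; have := vmax u uM; rewrite !phi_psi// lerD2r.
(* If [v] is heavier than [m], monotonicity excludes a smaller degree; if equally heavy, the tie
   rule does. Hence the position of [v] has room for [S]. *)
have dmv : (d m <= d v)%N.
  have [wmv|wvm] := eqVneq (w v) (w m); first exact: mtie.
  rewrite leqNgt; apply/negP => /(mono _ _ vM mM) wle.
  by move/eqP: wvm; apply; apply/eqP; rewrite eq_le wle mmin.
(* Being pendant, [v] has exactly one neighbour in [M], and its other neighbours are branches in
   [W]. *)
have cL : #|[set x in W | p x == v]| = (d v).-1.
  have [z [zM zv pz]] := exists_child rp (skel_M sp) M1 vM.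
  rewrite -degp (deg_skeletal inv rp vM sp vM) eqxx addn0.
  rewrite [X in (X + _)%N](_ : _ = 1%N) //.
  apply/eqP/cards1P; exists z; apply/setP => y; rewrite !inE.
  apply/idP/eqP => [/and3P[yM yv /eqP py]|->]; last by rewrite zM zv pz eqxx.
  have child x : x != v -> p x = v -> T v x.
    by move=> xv pxv; rewrite Tp parent_rel_sym -pxv (parent_rel_parent rp).
  by apply: vpend => //; exact: child.
have w0 x : x \in W -> 0 <= w x.
  by move=> xW; rewrite (inv_w inv) ?inE ?xW// sumr_ge0.
have d0 : (0 < d m)%N := ltnW (inv_degM inv mM).
have SleL : (#|S| <= (d v).-1)%N by rewrite cS; lia.
have SL : m = v -> #|S| = (d v).-1 by move=> <-.
have [q [qM qS qcard qcardv qle]] :=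
  reassign SW mM (skel_W sp) w0 wS psimax cL SleL SL.
pose p' := relabel W M up p q v m.
have rp' : rooted m p' := relabel_rooted inv vM mM rp sp qM.
have sp' : skeletal W M up p' := relabel_skeletal inv vM mM sp qM.
exists (parent_rel p'); split.
- apply: (rooted_tree_with_degrees dsum rp') => u.
  have [uM|uM] := boolP (u \in M); last by rewrite (deg_relabel_out inv vM mM rp sp qM).
  have := deg_relabel_in inv vM mM rp sp qM uM; rewrite -/p' degp.
  have dv0 : (0 < d v)%N := ltnW (inv_degM inv vM).
  (* The label [m] takes the position of [v] with [d m - 1] branches; the label [v] takes that of
     [m], where the surplus [d v - d m] restores its degree. *)
  have [->|um] := eqVneq u m.
    rewrite tpermR qcardv cL cS; lia.
  have suv : tperm v m u != v by rewrite tperm_eq tpermL.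
  rewrite qcard//.
  have [uv|uv] := eqVneq u v.
    rewrite uv tpermL eqxx cS; move: #|_| => c; lia.
  have su : tperm v m u = u by rewrite tpermD// eq_sym.
  by rewrite su (negPf um) addn0 => /addIn.
- by move=> x y; exact: (parent_rel_relabel inv vM mM sp qM).
(* [A] and [B] give the old and new anchor of [y], both as positions in [T]; thus both indices
   become sums of distances in the same tree. *)
pose B y := tperm v m (anchor M rt p' y).
have rtW y : rt y \notin M -> rt y \in W.
  move=> rM; apply: (inv_rtW inv); apply: contra rM => yM.
  by rewrite (inv_rt inv)// inE yM orbT.
have BE y : B y = if rt y \in M then tperm v m (rt y) else q (rt y).
  rewrite /B /anchor; case: ifP => // /negbT rM.
  by rewrite /p' (relabelW inv _ _ _ _ (rtW _ rM)) tpermK.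
have BM y : anchor M rt p' y \in M := anchorM inv sp' y.
have dT y z : dist T y z = (inner_dist M up y z + dist T (A y) (A z))%N.
  by rewrite !(dist_cutdist rp Tp); exact: (cutdist_anchor inv vM rp sp).
have dT' y z : dist (parent_rel p') y z = (inner_dist M up y z + dist T (B y) (B z))%N.
  rewrite (dist_cutdist rp' (fun _ _ => erefl)) (dist_cutdist rp Tp).
  rewrite (cutdist_anchor inv mM rp' sp'); congr (_ + _)%N.
  exact: (cutdist_relabel inv vM mM rp sp qM).
pose F a b : R := \sum_y \sum_z mu y * mu z * (dist T (a y) (b z))%:R.
have FC a b : F a b = F b a.
  rewrite /F exchange_big; apply: eq_bigr => y _; apply: eq_bigr => z _ /=.
  by rewrite distC// [mu z * _]mulrC.
(* The first-order estimate: the branches are handled by [reassign], and swapping [v] with [m] gains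
   [(w v - w m) * (psi v - psi m)], nonnegative by the choices of [m] and [v]. *)
have FBA : F B A <= F A A.
  have FE a : F a A = \sum_y mu y * psi (a y).
    by apply: eq_bigr => y _; rewrite mulr_sumr; apply: eq_bigr => z _; rewrite mulrA.
  rewrite !FE.
  rewrite (eq_bigr (fun y => mu y * psi (if rt y \in M then tperm v m (rt y) else q (rt y))));
    last by move=> y _; rewrite BE.
  rewrite (sum_rt inv (fun x => psi (if x \in M then tperm v m x else q x))).
  rewrite (sum_rt inv (fun x => psi (if x \in M then x else p x))).
  apply: lerD; last first.
    rewrite (eq_bigr (fun x => w x * psi (q x))); last first.
      by move=> x /(inv_disj inv)/negPf->.
    rewrite [leRHS](eq_bigr (fun x => w x * psi (p x))) //.
    by move=> x /(inv_disj inv)/negPf->.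
  rewrite (eq_bigr (fun x => w x * psi (tperm v m x))); last by move=> x ->.
  rewrite [leRHS](eq_bigr (fun x => w x * psi x)); last by move=> x ->.
  have [vm|vm] := eqVneq v m.
    by apply: ler_sum => x _; rewrite vm tperm1 perm1.
  rewrite (bigD1 v)//= (bigD1 m)/=; last by rewrite mM eq_sym.
  rewrite [leRHS](bigD1 v)//= [X in _ <= _ + X](bigD1 m)/=; last by rewrite mM eq_sym.
  rewrite !addrA lerD//.
    rewrite tpermL tpermR; have := mmin v vM; have := psimax m mM; nra.
  by apply: ler_sum => x /andP[/andP[_ xv] xm]; rewrite tpermD// eq_sym.
have split_dist (D : 'I_n -> 'I_n -> nat) a :
    (forall y z, D y z = inner_dist M up y z + dist T (a y) (a z))%N ->
  \sum_y \sum_z mu y * mu z * (D y z)%:R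
    = \sum_y \sum_z mu y * mu z * (inner_dist M up y z)%:R + F a a.
  move=> DE; rewrite -big_split; apply: eq_bigr => y _; rewrite -big_split.
  by apply: eq_bigr => z _; rewrite DE natrD mulrDr.
rewrite (split_dist _ _ dT') (split_dist _ _ dT) lerD2l.
(* The second-order estimate: F(B,B) <= 2 F(B,A) - F(A,A) <= F(A,A). *)
have := dist_negative_type mu A B treeT.
rewrite (_ : \sum_y _ = F A A + F B B - F A B - F B A).
  by rewrite [F A B]FC; move: FBA; lra.
rewrite /F -big_split -!sumrB; apply: eq_bigr => y _ /=.
rewrite -big_split -!sumrB; apply: eq_bigr => z _ /=; ring.
Qed.

(** * Optimality of Huffman trees *)

Lemma eq_dist n (e1 e2 : rel 'I_n) i j : e1 =2 e2 -> dist e1 i j = dist e2 i j.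
Proof.
move=> e12; apply: eq_find => k; elim: k j => //= k IHk j.
by rewrite IHk; congr (_ || _); apply: eq_existsb => z; rewrite IHk e12.
Qed.

(** The components of [S] merge into one rooted at [m]. Their roots receive their last edge, while
    [m], with [d m - 1] edges, lacks just one and so becomes free. *)
Lemma huff_inv_step (R : realFieldType) n (d : 'I_n -> nat) (mu : 'I_n -> R)
    (W M : {set 'I_n}) (w : 'I_n -> R) (E : rel 'I_n) up rt (m : 'I_n) (S : {set 'I_n}) :
  huff_inv d mu W M w E up rt -> m \in M -> S \subset W -> #|S| = (d m).-1 ->
  huff_inv d mu (m |: (W :\: S)) (M :\ m)
    (fun x => if x == m then w m + \sum_(s in S) w s else w x) (add_star E m S)
    (fun y => if y \in S then m else up y) (fun y => if rt y \in S then m else rt y).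
Proof.
move=> inv mM SW cS.
have SnM x : x \in S -> x \notin M by move=> /(subsetP SW)/(inv_disj inv).
have mS : m \notin S by apply: contraL mM => /SnM.
have WM x : x \in (m |: (W :\: S)) :|: (M :\ m) -> (x \in W :|: M) && (x \notin S).
  rewrite !inE => /orP[/orP[/eqP->|/andP[-> ->//]]|/andP[_ xM]].
    by rewrite mM orbT.
  by rewrite xM orbT; apply: contraL xM => /SnM.
have nWM x : x \notin (m |: (W :\: S)) :|: (M :\ m) ->
    (x \in S) || (x \notin W :|: M) && (x != m).
  rewrite !inE !negb_or => /andP[/andP[xm]]; rewrite xm /= negb_and negbK.
  by case: (x \in S) => //= -> ->.
have upm : up m = m by rewrite (inv_up inv)// inE mM orbT.
have rtm : rt m = m by rewrite (inv_rt inv)// inE mM orbT.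
split.
- move=> x; rewrite !inE negb_and => /orP[->//|/andP[_ xW]].
  by rewrite (inv_disj inv xW) orbT.
- by move=> x /WM/andP[xWM /negPf->]; exact: (inv_up inv).
- move=> x; rewrite !inE !negb_and !negbK; case: ifP => [_|_]; first by rewrite eqxx.
  by case/orP=> [/eqP->|/(inv_upM inv)->]; rewrite ?upm ?eqxx ?orbT.
- move=> x y; rewrite /add_star (inv_E inv) /parent_rel.
  have upS z : z \in S -> up z = z.
    by move=> zS; rewrite (inv_up inv)// inE (subsetP SW).
  have [->|xy] /= := eqVneq x y.
    by rewrite orbb; apply/andP => -[/eqP->]; rewrite (negPf mS).
  have [xS|xS] := boolP (x \in S); have [yS|yS] := boolP (y \in S);
    rewrite ?andbT ?andbF ?orbF ?(upS x xS) ?(upS y yS) ?[y == x]eq_sym ?(negPf xy) //=.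
  + by rewrite orbC ![_ == m]eq_sym.
  + by rewrite orbC [y == m]eq_sym.
  + by rewrite orbF [x == m]eq_sym.
- by move=> x /WM/andP[xWM xS]; rewrite (inv_rt inv)// (negPf xS).
- move=> x; rewrite !inE negb_and negbK => xM.
  have [->|xm] := eqVneq x m; first by rewrite rtm (negPf mS) eqxx.
  have xW : rt x \in W by apply: (inv_rtW inv); rewrite (negPf xm) in xM.
  by case: ifP => [_|rS]; rewrite ?eqxx// rS xW orbT.
- move=> x; have [xS|xS] := boolP (x \in S); last by rewrite (inv_rt_up inv).
  by rewrite rtm (negPf mS) (inv_rt inv (_ : x \in W :|: M)) ?xS// inE (subsetP SW).
- move=> x /WM/andP[xWM xS]; have [->|xm] := eqVneq x m; last first.
    rewrite (inv_w inv)//; apply: eq_bigl => y; case: ifP => // rS.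
    by rewrite [m == x]eq_sym (negPf xm); apply: contraNF xS => /eqP<-.
  rewrite (inv_w inv) ?inE ?mM ?orbT// [RHS](bigID (fun y => rt y \in S)) /= addrC.
  congr (_ + _).
    apply: eq_bigl => y; have [rS|rS] /= := boolP (rt y \in S); last by rewrite andbT.
    by rewrite andbF; apply: contraTF rS => /eqP->.
  rewrite (eq_bigr (fun s => \sum_(y | rt y == s) mu y)); last first.
    by move=> s sS; rewrite (inv_w inv)// inE (subsetP SW).
  rewrite [RHS](partition_big rt (mem S)) /= => [|y /andP[]//].
  apply: eq_bigr => s sS; apply: eq_bigl => y; have [->|] := eqVneq (rt y) s.
    by rewrite sS eqxx.
  by rewrite andbF.
- move=> x /nWM/orP[xS|/andP[xd xm]].
    rewrite -(inv_degW inv (subsetP SW x xS)) -add1n.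
    rewrite (_ : (1 + _)%N = #|m |: [set z | E x z]|); last first.
      rewrite cardsU1 inE (inv_E inv) parent_rel_sym -(inv_E inv).
      by rewrite (inv_ME inv _ mM).
    have /negPf xm : x != m by apply: contraTneq xS => ->.
    by apply: eq_card => z; rewrite !inE /add_star xS xm andbT orbC.
  rewrite -(inv_deg inv xd); apply: eq_card => z; rewrite !inE /add_star (negPf xm) /=.
  have [/(subsetP SW) xW|_] := boolP (x \in S); first by rewrite inE xW in xd.
  by rewrite andbF orbF.
- move=> x; rewrite !inE => /orP[/eqP->|/andP[xS xW]].
    have -> : deg (add_star E m S) m = #|S|.
      by apply: eq_card => z; rewrite inE /add_star (inv_ME inv _ mM) eqxx (negPf mS) andbF orbF.
    by rewrite cS prednK// ltnW// (inv_degM inv mM).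
  rewrite -(inv_degW inv xW); congr _.+1; apply: eq_card => z; rewrite !inE /add_star.
  have /negPf-> : x != m by apply: contraTneq xW => ->; apply: contraL mM; exact: (inv_disj inv).
  by rewrite (negPf xS) andbF !orbF.
- by move=> x; rewrite !inE => /andP[_ /(inv_degM inv)].
Qed.

(** Induction on the run with [T] varying: each step replaces [T] by the tree from [exchange], of no
    greater index, which contains the enlarged forest. *)
Lemma huff_run_optimal (R : realFieldType) n (d : 'I_n -> nat) (mu : 'I_n -> R)
    (W M : {set 'I_n}) (w : 'I_n -> R) (E H T : rel 'I_n) up rt :
  generating_degseq d -> (forall x, 0 <= mu x) -> huff_run d W M w E H ->
  M != set0 -> huff_inv d mu W M w E up rt ->
  (forall i j, i \in M -> j \in M -> (d i < d j)%N -> mu i <= mu j) ->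
  tree_with_degrees d T -> (forall x y, E x y -> T x y) ->
  \sum_y \sum_z mu y * mu z * (dist H y z)%:R <= \sum_y \sum_z mu y * mu z * (dist T y z)%:R.
Proof.
move=> dsum mu0 run; elim: run up rt T => {W M w E H}.
- move=> W M w E H m S M1 mM mmin mtie SW cS wS _ IH up rt T _ inv mono tT ET.
  have monow i j : i \in M -> j \in M -> (d i < d j)%N -> w i <= w j.
    by move=> iM jM; rewrite !(inv_wM inv)//; exact: mono.
  have [T' [tT' ET' le]] := exchange dsum mu0 inv monow tT ET M1 mM mmin mtie SW cS wS.
  apply: le_trans le; apply: IH tT' ET'.
  + by rewrite -card_gt0; rewrite (cardsD1 m) mM in M1.
  + exact: (huff_inv_step inv mM SW cS).
  + by move=> i j; rewrite !inE => /andP[_ iM] /andP[_ jM]; exact: mono.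
- move=> W M w E m Mm up rt T _ inv _ [treeT degT] ET.
  have mM : m \in M by rewrite Mm set11.
  have [p [rp Tp]] := tree_rooted m treeT.
  have sp := tree_skeletal inv degT ET mM rp Tp.
  have pW x : x \in W -> p x = m by move=> /(skel_W sp); rewrite Mm => /set1P.
  have ET' x y : parent_rel p x y -> p x = y -> add_star E m W x y.
    move=> /andP[xy _] pxy; rewrite /add_star.
    have [xW|xW] := boolP (x \in W); first by rewrite -pxy pW// eqxx !orbT.
    have [xm|xm] := eqVneq x m; first by rewrite -pxy xm (rooted_root rp) eqxx in xy.
    have xd : x \notin W :|: M by rewrite Mm !inE negb_or xW.
    by rewrite (inv_E inv) /parent_rel xy -(skel_up sp xd) pxy eqxx.
  have starC x y : add_star E m W x y = add_star E m W y x.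
    by rewrite /add_star (inv_E inv) parent_rel_sym -(inv_E inv); congr (_ || _); rewrite orbC.
  (* With one internal vertex left the skeleton is a point, so every free vertex hangs from [m] and
     [T] is already the output. *)
  have eqT : add_star E m W =2 T.
    move=> x y; apply/idP/idP; last first.
      rewrite Tp => pxy; case/andP: (pxy) => _ /orP[/eqP|/eqP pyx]; first exact: ET'.
      by rewrite starC ET'// parent_rel_sym.
    have TW z : z \in W -> T m z.
      move=> zW; rewrite Tp parent_rel_sym -(pW z zW) (parent_rel_parent rp)//.
      by apply: contraTneq zW => ->; apply: contraL mM; exact: (inv_disj inv).
    have [Tsym _ _ _] := treeT.
    move=> /or3P[/ET//|/andP[/eqP-> /TW]//|/andP[/eqP-> /TW]].
    by rewrite Tsym.
  rewrite le_eqVlt; apply/orP; left; apply/eqP.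
  by apply: eq_bigr => y _; apply: eq_bigr => z _; rewrite (eq_dist _ _ eqT).
- by move=> W M w E a b -> _ _ up rt T; rewrite eqxx.
Qed.

Lemma huff_run_no_internal (R : numDomainType) n (d : 'I_n -> nat) (W M : {set 'I_n})
    (w : 'I_n -> R) (E H : rel 'I_n) :
  huff_run d W M w E H -> M = set0 ->
  exists a b, [/\ a != b, W = [set a; b] & H = add_star E a [set b]].
Proof.
case=> {W M w E H}.
- by move=> W M w E H m S _ + _ _ _ _ _ _ M0; rewrite M0 inE.
- by move=> W M w E m -> /setP/(_ m); rewrite !inE eqxx.
- by move=> W M w E a b _ ab -> _; exists a, b.
Qed.

Lemma tree_deg_gt0 n (d : 'I_n -> nat) (T : rel 'I_n) x y :
  tree_with_degrees d T -> x != y -> (0 < d x)%N.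
Proof.
move=> [treeT degT] xy; have [p [rp Tp]] := tree_rooted y treeT.
rewrite -degT; apply/card_gt0P; exists (p x).
by rewrite inE Tp (parent_rel_parent rp).
Qed.

Lemma huffman_wiener_le (R : realFieldType) n (mu : 'cV[R]_n) (d : 'I_n -> nat) (H T : rel 'I_n) :
  generating_degseq d -> (forall i, 0 <= mu i 0) -> monotone_in mu d ->
  huffman_tree mu d H -> tree_with_degrees d T -> wiener mu H <= wiener mu T.
Proof.
move=> dsum mu0 mono run tT; rewrite !wienerE.
pose M := [set i | (1 < d i)%N].
(* Without internal vertices every vertex is a leaf, and both trees are the single edge between [a]
   and [b]. *)
have [M0|/set0Pn[m]] := eqVneq M set0.
  have [a [b [ab Wab Hab]]] := huff_run_no_internal run M0.
  have all_ab x : (x == a) || (x == b).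
    have : x \in [set i | d i == 1%N].
      have /setP/(_ x) := M0; rewrite !inE => /negbT; rewrite -leqNgt => d1.
      have d0 : (0 < d x)%N.
        have [->|xa] := eqVneq x a; first exact: tree_deg_gt0 tT ab.
        exact: tree_deg_gt0 tT xa.
      by rewrite eqn_leq d1.
    by rewrite Wab !inE.
  have [[Tsym Tirr _ _] degT] := tT.
  have Tab : T a b.
    have := tree_deg_gt0 tT ab; rewrite -degT => /card_gt0P[z]; rewrite inE.
    by have /orP[/eqP->|/eqP->] := all_ab z; rewrite ?Tirr.
  have eqT : H =2 T.
    move=> x y; rewrite Hab /add_star /= !inE.
    have /orP[/eqP->|/eqP->] := all_ab x; have /orP[/eqP->|/eqP->] := all_ab y;
      by rewrite ?eqxx ?Tirr ?(negPf ab) ?[b == a]eq_sym ?(negPf ab) ?Tab //= Tsym Tab.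
  rewrite le_eqVlt; apply/orP; left; apply/eqP.
  by apply: eq_bigr => y _; apply: eq_bigr => z _; rewrite (eq_dist _ _ eqT).
rewrite inE => dm.
have d_gt0 x : (0 < d x)%N.
  have [->|xm] := eqVneq x m; first exact: ltnW.
  exact: tree_deg_gt0 tT xm.
(* At the start the forest has no edges, so each vertex is its own parent and its own component
   root. *)
apply: (huff_run_optimal (mu := fun i => mu i 0) (up := id) (rt := id) dsum mu0 run _ _ _ tT) => //.
- by apply/set0Pn; exists m; rewrite inE.
- have deg0 x : deg (fun _ _ : 'I_n => false) x = 0%N.
    by rewrite /deg; apply: eq_card0 => z; rewrite inE.
  split=> //.
  + by move=> x; rewrite !inE => /eqP->.
  + by move=> x y; rewrite /parent_rel /= orbC eq_sym orbb andbC; case: eqP.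
  + by move=> x; rewrite !inE -leqNgt eqn_leq d_gt0 andbT.
  + by move=> x _; rewrite big_pred1_eq.
  + by move=> x; rewrite !inE deg0; case: (d x) (d_gt0 x) => [|[|]].
  + by move=> x; rewrite inE deg0 => /eqP->.
  + by move=> x; rewrite inE.
- by move=> i j; rewrite !inE => di _; exact: mono.
Qed.

(** * From the trace inequality and Huffman optimality to the bound on the cost *)

Theorem theorem2 (R : realFieldType) (n : nat) (A : 'M[R]_n) (d : 'I_n -> nat)
    (alpha mu : 'cV[R]_n) (H T : rel 'I_n) :
  A^T = A ->
  (forall i j, 0 <= A i j) ->
  generating_degseq d ->
  (forall i, 0 <= mu i 0) ->
  monotone_in mu d ->
  psd (diag_mx alpha^T + mu *m mu^T - A) ->
  huffman_tree mu d H ->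
  tree_with_degrees d T ->
  LB A alpha mu H <= cost A T.
Proof.
move=> _ _ dsum mu0 mono psdM run tT.
have [treeT _] := tT.
have wHT := huffman_wiener_le dsum mu0 mono run tT.
have := trace_Pmx_psd treeT psdM.
have trJ (B : 'M[R]_n) : \tr (const_mx 1 *m B) = \sum_i \sum_j B i j.
  rewrite exchange_big; apply: eq_bigr => i _; rewrite mxE.
  by apply: eq_bigr => j _; rewrite mxE mul1r.
set c : R := (n - 1)%:R / 2.
have PE (e : rel 'I_n) (B : 'M[R]_n) :
    \tr (Pmx R e *m B) = c * (\sum_i \sum_j B i j) - \tr (distmx R e *m B).
  by rewrite /Pmx mulmxBl -scalemxAl linearB /= mxtraceZ trJ.
(* Distances vanish on the diagonal, so every diagonal entry of P(T) equals [c]. *)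
have trD : \tr (Pmx R T *m diag_mx alpha^T) = c * \sum_i alpha i 0.
  rewrite mul_mx_diag mulr_sumr; apply: eq_bigr => i _; rewrite !mxE.
  have [p [rp Tp]] := tree_rooted i treeT.
  have /eqP-> : dist T i i == 0%N by rewrite (dist_cutdist rp Tp) (cutdist_eq0 rp).
  by rewrite mulr1 subr0.
have muP e : \tr (Pmx R e *m (mu *m mu^T)) = (mu^T *m Pmx R e *m mu) 0 0.
  by rewrite mulmxA mxtrace_mulC trace_mx11 mulmxA.
have wienerP e : (mu^T *m Pmx R e *m mu) 0 0
    = c * (\sum_i \sum_j (mu *m mu^T) i j) - wiener mu e.
  by rewrite -muP PE /wiener mulmxA mxtrace_mulC trace_mx11 mulmxA.
(* The trace inequality bounds the cost below by [LB] with [T] in place of [H]; the smaller Wiener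
   index of [H] makes its form in P at least that of [T]. *)
rewrite mulmxBr mulmxDr linearB linearD /= trD muP PE -/(cost A T) /LB -/c !wienerP.
lra.
Qed.
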